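(* For every simple signed graph $\widehat G$, the double cover $\mathrm{DC}(\widehat G)$ is $C_6$-free if and only if $\widehat G$ is $\{C_{-3},C_{+6}\}$-free.
   Context: All graphs are finite and simple. A signed graph is a pair $\widehat G=(G,\sigma)$ with $\sigma:E(G)\to\{+1,-1\}$; the sign of a cycle is the product of its edge signs. A signed graph is $\{C_{-3},C_{+6}\}$-free if it contains no triangle of sign $-1$ and no $6$-cycle of sign $+1$. The double cover $\mathrm{DC}(\widehat G)$ is the ordinary graph on $\{v^+:v\in V(G)\}\sqcup\{v^-:v\in V(G)\}$ in which each positive edge $uv$ gives the edges $u^+v^+$ and $u^-v^-$, and each negative edge $uv$ gives the edges $u^+v^-$ and $u^-v^+$. A graph is $C_6$-free if it contains no cycle of length $6$ as a subgraph. *)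

(* Defs.v *)
From HB Require Import structures.
From mathcomp Require Import all_boot all_order all_algebra.
Set Implicit Arguments.
Unset Strict Implicit.
Unset Printing Implicit Defensive.
Import GRing.Theory.
Local Open Scope ring_scope.

Record sgraph := SGraph {
  vertex :> finType;
  adj : rel vertex;
  adj_sym : symmetric adj;
  adj_irr : irreflexive adj }.

Definition edges (G : sgraph) : {set {set G}} :=
  [set [set p.1; p.2] | p : G * G & adj p.1 p.2].

(* The values of the signature outside [edges] are irrelevant. *)
Record signed_graph := SignedGraph {
  underlying :> sgraph;
  sigma : {set underlying} -> int;
  sigma_pm1 : forall e, e \in edges underlying -> sigma e = 1 \/ sigma e = -1 }.

(* A cycle is represented by the sequence of its vertices, for some choice of
   a starting vertex and a direction; [ucycle] alone also accepts the empty
   sequence and a doubled edge, hence the bound on the size. *)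
Definition is_cycle (G : sgraph) (c : seq G) : Prop :=
  (2 < size c)%N /\ ucycle (@adj G) c.

Definition cycle_sign (G : signed_graph) (c : seq G) : int :=
  \prod_(x <- c) sigma [set x; next c x].

Definition cycle_free (k : nat) (G : sgraph) : Prop :=
  ~ exists c : seq G, is_cycle c /\ size c = k.

Definition signed_cycle_free (s : int) (k : nat) (G : signed_graph) : Prop :=
  ~ exists c : seq G, [/\ is_cycle c, size c = k & cycle_sign c = s].

Section DoubleCover.
Variable G : signed_graph.

(* [inl v] is v^+ and [inr v] is v^-. *)
Definition dc_adj : rel (G + G)%type := fun x y =>
  match x, y with
  | inl u, inl v | inr u, inr v => adj u v && (sigma [set u; v] == 1)
  | inl u, inr v | inr u, inl v => adj u v && (sigma [set u; v] == -1)
  end.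

Lemma dc_adj_sym : symmetric dc_adj.
Proof. by move=> [u|u] [v|v] /=; rewrite adj_sym setUC. Qed.

Lemma dc_adj_irr : irreflexive dc_adj.
Proof. by move=> [u|u] /=; rewrite adj_irr. Qed.

Definition double_cover : sgraph := SGraph dc_adj_sym dc_adj_irr.

End DoubleCover.

(* Main.v *)
(** The projection of a 6-cycle of the double cover is a closed walk of length 6
    with sign [+1], and a vertex repeated in it appears once on each level, so that
    both arcs between its two occurrences are negative closed walks. Such an
    arc is not of length 2 (it would use one edge twice), hence either it is
    a negative triangle, or no vertex is repeated. Conversely, a positive
    6-cycle lifts to a 6-cycle, and so does a negative triangle run twice. *)

Require Import Defs.
From mathcomp Require Import all_boot all_order all_algebra.
Set Implicit Arguments.
Unset Strict Implicit.
Unset Printing Implicit Defensive.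
Import GRing.Theory.
Local Open Scope ring_scope.

Definition negative (G : signed_graph) (u v : G) : bool :=
  sigma [set u; v] == -1.

Lemma negativeC (G : signed_graph) (u v : G) : negative u v = negative v u.
Proof. by rewrite /negative setUC. Qed.

Lemma adj_neq (G : sgraph) (u v : G) : adj u v -> u != v.
Proof. by apply: contraL => /eqP->; rewrite adj_irr. Qed.

Lemma edge_in_edges (G : sgraph) (u v : G) :
  adj u v -> [set u; v] \in edges G.
Proof. by move=> uv; apply/imsetP; exists (u, v); rewrite ?inE. Qed.

Lemma sigma_negative (G : signed_graph) (u v : G) :
  adj u v -> sigma [set u; v] = (-1) ^+ negative u v.
Proof.
move=> /edge_in_edges/sigma_pm1; rewrite /negative.
by case=> ->; rewrite ?eqxx.
Qed.

(** [next] locates a vertex by its first occurrence; without repetitions it is the successor by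
    position, which gives a form suited to induction. *)
Lemma cycle_sign_prod (G : signed_graph) (x : G) (p : seq G) :
  uniq (x :: p) ->
  cycle_sign (x :: p) =
    \prod_(s <- pairmap (fun u v => sigma [set u; v]) x (rcons p x)) s.
Proof.
move=> Up; rewrite /cycle_sign [LHS](big_nth x) [RHS](big_nth 0) size_pairmap size_rcons.
apply: eq_big_nat => i /andP[_ lti].
rewrite (nth_pairmap x) ?size_rcons // -rcons_cons.
rewrite [nth x (rcons _ _) i]nth_rcons lti.
(* At the last position [nth x p i] is out of range and its default [x] is the closing vertex of
   [rcons p x]. *)
rewrite next_nth mem_nth // index_uniq // nth_rcons.
by case: ltnP => // le_pi; rewrite [nth x p i]nth_default // if_same.
Qed.

Lemma cycle_sign_parity (G : signed_graph) (x : G) (p : seq G) :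
  ucycle (@adj G) (x :: p) ->
  cycle_sign (x :: p) =
    (-1) ^+ foldr addb false (pairmap (@negative G) x (rcons p x)).
Proof.
case/andP=> /= + /cycle_sign_prod ->.
(* The induction runs over arbitrary walks, closed or not. *)
move: (rcons p x) => q; elim: q x => [|y q IHq] x /=; first by rewrite big_nil.
by case/andP=> xy /IHq; rewrite big_cons signr_addb sigma_negative // => ->.
Qed.

Lemma signr_eqN1 (b : bool) : (((-1) ^+ b : int) = -1) <-> b.
Proof. by case: b. Qed.

Lemma signr_eq1 (b : bool) : (((-1) ^+ b : int) = 1) <-> ~~ b.
Proof. by case: b. Qed.

(** Levels are bits, with [true] for the minus level, so that following an edge adds its [negative]
    bit to the level. *)
Definition lift_vertex (G : signed_graph) (b : bool) (v : G) :
  double_cover G := if b then inr v else inl v.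
Arguments lift_vertex : simpl never.
Arguments adj : simpl never.

Lemma lift_vertexP (G : signed_graph) (x : double_cover G) :
  exists b v, x = lift_vertex b v.
Proof. by case: x => v; [exists false | exists true]; exists v. Qed.

Lemma eq_lift_vertex (G : signed_graph) (a b : bool) (u v : G) :
  (lift_vertex a u == lift_vertex b v) = (a == b) && (u == v).
Proof. by case: a; case: b. Qed.

Lemma adj_lift_vertex (G : signed_graph) (a b : bool) (u v : G) :
  adj (lift_vertex a u) (lift_vertex b v) =
    adj u v && (b == a (+) negative u v).
Proof.
rewrite -[LHS]/(dc_adj (lift_vertex a u) (lift_vertex b v)).
have [uv|/negbTE uv] := boolP (adj u v); last by case: a b => [] []; rewrite /= uv.
by case: a b => [] []; rewrite /= uv sigma_negative //; case: negative.
Qed.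

Lemma negative_triangle_lift (G : signed_graph) :
  cycle_free 6 (double_cover G) -> signed_cycle_free (-1) 3 G.
Proof.
move=> free6 [c [[_ uc] sz]]; case: c sz uc => [|u [|v [|w [|? ?]]]] // _ uc.
rewrite cycle_sign_parity // => /signr_eqN1 /=.
set m := @negative G => odd_m; case: free6.
(* The triangle is run twice: its odd parity makes the first turn end at [u] on the minus level, so
   the second turn meets every vertex on the other level. *)
exists [:: lift_vertex false u; lift_vertex (m u v) v;
  lift_vertex (m u v (+) m v w) w; lift_vertex true u;
  lift_vertex (~~ m u v) v; lift_vertex (~~ (m u v (+) m v w)) w].
split=> //; split=> //; move: uc odd_m.
rewrite /ucycle [cycle _ _]/= [uniq _]/= !inE => /andP[/and4P[uv vw wu _]].
rewrite !andbT => /andP[/norP[u_v u_w] v_w].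
rewrite /ucycle [cycle _ _]/= [uniq _]/= !inE !adj_lift_vertex !eq_lift_vertex.
rewrite -/m uv vw wu ![v == u]eq_sym ![w == u]eq_sym ![w == v]eq_sym.
rewrite (negbTE u_v) (negbTE u_w) (negbTE v_w) !eqxx.
by case: (m u v); case: (m v w); case: (m w u).
Qed.

Lemma positive_hexagon_lift (G : signed_graph) :
  cycle_free 6 (double_cover G) -> signed_cycle_free 1 6 G.
Proof.
move=> free6 [c [[_ uc] sz]].
case: c sz uc => [|u0 [|u1 [|u2 [|u3 [|u4 [|u5 [|? ?]]]]]]] // _ uc.
rewrite cycle_sign_parity // => /signr_eq1 /=.
set m := @negative G => even_m; case: free6.
(* Each [b] is the level reached at that vertex by the walk that starts at [u0] on the plus
   level. *)
pose b1 := m u0 u1; pose b2 := b1 (+) m u1 u2; pose b3 := b2 (+) m u2 u3.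
pose b4 := b3 (+) m u3 u4; pose b5 := b4 (+) m u4 u5.
pose c := [:: lift_vertex false u0; lift_vertex b1 u1; lift_vertex b2 u2;
  lift_vertex b3 u3; lift_vertex b4 u4; lift_vertex b5 u5].
exists c; split=> //; split=> //; case/andP: uc => uc Uc; apply/andP; split.
  (* Even parity closes the lifted walk on its starting level. *)
  have b0E : false == b5 (+) m u5 u0.
    by move: even_m; rewrite addbF /b5 /b4 /b3 /b2 /b1 !addbA => /negbTE->.
  case/and5P: uc => h0 h1 h2 h3 /and3P[h4 h5 _].
  rewrite /c [cycle _ _]/= !adj_lift_vertex -/m h0 h1 h2 h3 h4 h5 b0E.
  by rewrite !eqxx.
pose proj (x : double_cover G) : G := match x with inl v | inr v => v end.
apply: (map_uniq (f := proj)).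
have projK b v : proj (lift_vertex b v) = v by case: b.
by rewrite /c /map !projK.
Qed.

(* Two occurrences at distance 3 cut the closed walk into two closed
   walks of length 3, negative since the levels of [u] differ. *)
Lemma antipodal_lift_neq (G : signed_graph) (a b c d : bool) (u v w x : G) :
  signed_cycle_free (-1) 3 G ->
  adj (lift_vertex a u) (lift_vertex b v) ->
  adj (lift_vertex b v) (lift_vertex c w) ->
  adj (lift_vertex c w) (lift_vertex d x) ->
  lift_vertex a u != lift_vertex d x -> u != x.
Proof.
rewrite !adj_lift_vertex eq_lift_vertex => free3.
case/andP=> uv /eqP-> /andP[vw /eqP->] /andP[+ /eqP->].
case: (eqVneq u x) => [<- wu|//]; rewrite andbT => odd_m; case: free3.
have uc : ucycle (@adj G) [:: u; v; w].
  rewrite /ucycle /= uv vw wu !inE negb_or (adj_neq uv) (adj_neq vw).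
  by rewrite eq_sym (adj_neq wu).
exists [:: u; v; w]; split=> //; rewrite cycle_sign_parity //.
apply/signr_eqN1; move: odd_m => /=.
by case: a; do !case: negative.
Qed.

(** Going back along the same edge adds the same bit twice, hence returns to the same lift. *)
Lemma distance2_lift_neq (G : signed_graph) (a b c : bool) (u v w : G) :
  adj (lift_vertex a u) (lift_vertex b v) ->
  adj (lift_vertex b v) (lift_vertex c w) ->
  lift_vertex a u != lift_vertex c w -> u != w.
Proof.
rewrite !adj_lift_vertex eq_lift_vertex => /andP[_ /eqP->] /andP[_ /eqP->].
by case: (eqVneq u w) => // <-; rewrite [negative v u]negativeC addbK eqxx.
Qed.

Lemma adj_lift_neq (G : signed_graph) (a b : bool) (u v : G) :
  adj (lift_vertex a u) (lift_vertex b v) -> u != v.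
Proof.
by rewrite adj_lift_vertex => /andP[/adj_neq].
Qed.

Lemma cycle_free6_double_cover (G : signed_graph) :
  signed_cycle_free (-1) 3 G -> signed_cycle_free 1 6 G ->
  cycle_free 6 (double_cover G).
Proof.
move=> free3 free6 [c [[_ uc] sz]]; move: c sz uc.
move=> [|x0 [|x1 [|x2 [|x3 [|x4 [|x5 [|? ?]]]]]]] // _.
have [b0 [u0 ->]] := lift_vertexP x0; have [b1 [u1 ->]] := lift_vertexP x1.
have [b2 [u2 ->]] := lift_vertexP x2; have [b3 [u3 ->]] := lift_vertexP x3.
have [b4 [u4 ->]] := lift_vertexP x4; have [b5 [u5 ->]] := lift_vertexP x5.
case/andP; rewrite [cycle _ _]/= [uniq _]/= !inE.
case/and5P=> h0 h1 h2 h3 /and3P[h4 h5 _].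
rewrite !negb_or !andbT => /and5P[/and5P[_ n02 n03 n04 _]].
case/and4P=> _ n13 n14 n15 /and3P[_ n24 n25] /andP[_ n35] _.
(* The fifteen pairs are six at distance 1, six at distance 2 and three antipodal ones. *)
have Uu : uniq [:: u0; u1; u2; u3; u4; u5].
  rewrite /= !inE !negb_or !andbT.
  rewrite (adj_lift_neq h0) (adj_lift_neq h1).
  rewrite (adj_lift_neq h2) (adj_lift_neq h3).
  rewrite (adj_lift_neq h4) [u0 == u5]eq_sym (adj_lift_neq h5).
  rewrite (distance2_lift_neq h0 h1 n02).
  rewrite (distance2_lift_neq h1 h2 n13).
  rewrite (distance2_lift_neq h2 h3 n24).
  rewrite (distance2_lift_neq h3 h4 n35).
  rewrite [u0 == u4]eq_sym (distance2_lift_neq h4 h5) 1?eq_sym //.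
  rewrite [u1 == u5]eq_sym (distance2_lift_neq h5 h0) 1?eq_sym //.
  rewrite (antipodal_lift_neq free3 h0 h1 h2 n03).
  rewrite (antipodal_lift_neq free3 h1 h2 h3 n14).
  by rewrite (antipodal_lift_neq free3 h2 h3 h4 n25).
case: free6; exists [:: u0; u1; u2; u3; u4; u5].
move: h0 h1 h2 h3 h4 h5; rewrite !adj_lift_vertex.
move=> /andP[e0 /eqP B1] /andP[e1 /eqP B2] /andP[e2 /eqP B3] /andP[e3 /eqP B4].
move=> /andP[e4 /eqP B5] /andP[e5 /eqP B0].
have uc : ucycle (@adj G) [:: u0; u1; u2; u3; u4; u5].
  by rewrite /ucycle Uu /= e0 e1 e2 e3 e4 e5.
split=> //; rewrite cycle_sign_parity //; apply/signr_eq1 => /=.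
(* Once around the hexagon, [b0] equals itself plus the parity; cancelling [b0] leaves even
   parity. *)
move: B0; rewrite B5 B4 B3 B2 B1 -!addbA => /(congr1 (addb b0)).
by rewrite addbb addKb addbF => <-.
Qed.

Theorem proposition5p1 (G : signed_graph) :
  cycle_free 6 (double_cover G) <->
  signed_cycle_free (-1) 3 G /\ signed_cycle_free 1 6 G.
Proof.
split=> [free6|[free3 free6]]; last exact: cycle_free6_double_cover.
by split; [exact: negative_triangle_lift | exact: positive_hexagon_lift].
Qed.
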